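(* Let $\mathcal{H}$ be a complex Hilbert space (not necessarily separable) with $\dim_{\mathbb{C}}\mathcal{H}\ge 2$. For a unit vector $\psi\in\mathbb{S}(\mathcal{H})$ and an event $E\neq 0$ on $\mathcal{H}$, let ${\rm P}_\psi(E) := \|E\psi\|^2$. Then ${\rm P}_\psi(E)$ passes down to a function of the point $x=\pi_2(\psi)\in\mathbb{CP}(\mathcal{H})$ and the (non-empty) complex projective subspace $S=\pi'(E)\subset\mathbb{CP}(\mathcal{H})$ only; that is, ${\rm P}_x(S) := {\rm P}_\psi(E)$ is well defined, and it is given by $${\rm P}_x(S) = \cos^2 d(x,S).$$
   Context: The Hermitian inner product $\langle\cdot,\cdot\rangle$ on $\mathcal{H}$ is conjugate linear in the first entry and linear in the second; $\|\cdot\|$ is its norm. Write $V^{\rm x} = V\setminus\{0\}$ for a vector space $V$, $\mathbb{S}(\mathcal{H}) = \{\psi\in\mathcal{H} : \|\psi\|=1\}$, and $\mathbb{CP}(\mathcal{H}) = \mathcal{H}^{\rm x}/\mathbb{C}^{\rm x} = \mathbb{S}(\mathcal{H})/S^1$, where $S^1$ is the group of unit complex numbers. The quotient maps are $\pi_2:\mathbb{S}(\mathcal{H})\to\mathbb{CP}(\mathcal{H})$ and $\pi_3:\mathcal{H}^{\rm x}\to\mathbb{CP}(\mathcal{H})$, $\pi_3(\psi)=\pi_2(\psi/\|\psi\|)$. Distance: $d(x,y)$ is the distance on $\mathbb{CP}(\mathcal{H})$ (infimum of lengths of $C^1$ curves) associated with the Fubini-Study Riemannian metric, normalized so that $\pi_2$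 is a Riemannian submersion from the unit sphere $\mathbb{S}(\mathcal{H})$ with the metric induced from the real inner product $\Re\langle\cdot,\cdot\rangle$; it is a known fact that $d(x,y)=\cos^{-1}|\langle\psi,\phi\rangle|\in[0,\pi/2]$ for any unit vectors $\psi\in\pi_2^{-1}(x)$, $\phi\in\pi_2^{-1}(y)$. For a non-empty subset $Y\subset\mathbb{CP}(\mathcal{H})$, $d(x,Y):=\inf\{d(x,y) : y\in Y\}$. Events and projective subspaces: an event is a bounded linear operator $E$ on $\mathcal{H}$ with $E=E^2=E^*$ (an orthogonal projection). A (complex) projective subspace of $\mathbb{CP}(\mathcal{H})$ is a set of the form $\pi_3(V^{\rm x})$ for a (unique) closed complex vector subspace $V$ of $\mathcal{H}$. The map $\pi'(E):=\pi_3(({\rm Ran}\,E)^{\rm x})$ is a bijection from events to projective subspaces, with $\pi'(0)=\emptyset$. *)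

(* Defs.v *)
From HB Require Import structures.
From mathcomp Require Import all_boot all_order all_algebra.
From mathcomp Require Import sesquilinear generic_quotient complex.
From mathcomp Require Import all_classical all_reals all_analysis.

Set Implicit Arguments.
Unset Strict Implicit.
Unset Printing Implicit Defensive.

Import Order.TTheory GRing.Theory Num.Theory.
Import numFieldNormedType.Exports.

Local Open Scope classical_set_scope.
Local Open Scope ring_scope.
Local Open Scope complex_scope.
Local Open Scope quotient_scope.

Section ProjectiveSpace.
Variables (R : realType) (H : normedModType R[i]).

(* The norm of a normedModType R[i] takes its values in R[i]. *)
Definition rnorm (u : H) : R := complex.Re `|u|.

Record sphere := Sphere { sphere_val :> H; sphereP : `|sphere_val| == 1 }.
HB.instance Definition _ := [isSub for sphere_val].
HB.instance Definition _ := [Choice of sphere by <:].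

Record nonzero := Nonzero { nonzero_val :> H; nonzeroP : nonzero_val != 0 }.

(* The orbit relation of the action of S^1 on the unit sphere. *)
Definition phase_eq (psi phi : sphere) : bool :=
  `[< exists2 z : R[i], `|z| = 1 & phi = z *: (psi : H) :> H >].

Lemma phase_eq_refl : reflexive phase_eq.
Proof. by move=> x; apply/asboolP; exists 1; rewrite ?normr1 ?scale1r. Qed.

Lemma phase_eq_sym : symmetric phase_eq.
Proof.
move=> x y; apply/asboolP/asboolP => -[z z1 e]; exists z^-1;
  by rewrite ?normfV ?z1 ?invr1// e scalerA mulVf ?scale1r// -normr_gt0 z1.
Qed.

Lemma phase_eq_trans : transitive phase_eq.
Proof.
move=> y x z /asboolP[a a1 ea] /asboolP[b b1 eb]; apply/asboolP.
by exists (b * a); rewrite ?normrM ?a1 ?b1 ?mulr1// eb ea scalerA.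
Qed.

Canonical phase_equiv :=
  EquivRel phase_eq phase_eq_refl phase_eq_sym phase_eq_trans.

Definition CP := {eq_quot phase_equiv}.

Definition pi2 (psi : sphere) : CP := \pi_CP psi.

Lemma normalize_subproof (psi : nonzero) :
  `| `|psi : H|^-1 *: (psi : H)| == 1.
Proof.
by rewrite normrZ normfV normr_id mulVf// normr_eq0; exact: nonzeroP.
Qed.

Definition normalize (psi : nonzero) : sphere := Sphere (normalize_subproof psi).

Definition pi3 (psi : nonzero) : CP := pi2 (normalize psi).

(* pi3 (V \ {0}) *)
Definition proj_set (V : set H) : set CP :=
  pi3 @` [set psi : nonzero | V psi].

Definition closed_vsubspace (V : set H) : Prop :=
  [/\ closed V, V 0 & forall (a : R[i]) u v, V u -> V v -> V (a *: u + v)].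

Definition projective_subspace (S : set CP) : Prop :=
  exists2 V : set H, closed_vsubspace V & S = proj_set V.

Definition bounded_op (E : H -> H) : Prop :=
  exists M : R, forall u, rnorm (E u) <= M * rnorm u.

Definition pi' (E : H -> H) : set CP := proj_set (range E).

Definition prob (psi : sphere) (E : H -> H) : R := rnorm (E psi) ^+ 2.

End ProjectiveSpace.

Section HilbertSpace.
Variables (R : realType) (H : normedModType R[i]).
Variable dot : {dot H for @Num.conj R[i]}.

(* A {dot _ for _} is linear in its first argument and conjugate linear in the
   second one; inner has the opposite convention. *)
Definition inner (u v : H) : R[i] := dot v u.

Definition inner_norm : Prop := forall u : H, `|u| ^+ 2 = inner u u.

Definition event (E : {linear H -> H}) : Prop :=
  [/\ bounded_op E, forall u, E (E u) = E u
    & forall u v, inner (E u) v = inner u (E v)].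

(* The derivative is with respect to a real parameter, whereas the scalars of H
   are complex, hence the explicit difference quotient. *)
Definition is_rderive (g : R -> H) (t : R) (v : H) : Prop :=
  (fun h : R => (h^-1)%:C *: (g (t + h) - g t)) @ 0^' --> v.

(* g is a C^1 lift to the sphere, defined near t, of the curve c of CP(H), and
   dg is its derivative. As pi2 is a submersion, c is C^1 near t if and only if
   it has such a lift. *)
Definition C1_lift (c : R -> CP H) (t : R) (g : R -> sphere H) (dg : R -> H) :=
  \forall s \near t, [/\ pi2 (g s) = c s,
    is_rderive (fun r => g r : H) s (dg s) & {for s, continuous dg}].

(* The orthogonal projection of v, a tangent vector to the sphere at psi
   (i.e. Re <psi, v> = 0), onto the horizontal space at psi, i.e. the orthogonal
   complement for Re <.,.> of the tangent space R 'i psi of the fibre of pi2.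
   As pi2 is a Riemannian submersion, the norm of the horizontal part of v is
   the Fubini-Study norm of the image of v by the differential of pi2. *)
Definition horizontal (psi : sphere H) (v : H) : H := v - inner psi v *: (psi : H).

(* c is C^1 near t, and its velocity at t has Fubini-Study norm v. *)
Definition has_FS_speed (c : R -> CP H) (t : R) (v : R) : Prop :=
  exists (g : R -> sphere H) (dg : R -> H),
    C1_lift c t g dg /\ v = rnorm (horizontal (g t) (dg t)).

(* The lengths of the C^1 curves [0, 1] -> CP(H) from x to y; a curve is C^1 on
   [0, 1] when it extends to a curve that is C^1 near each point of [0, 1]. *)
Definition FS_lengths (x y : CP H) : set R :=
  [set L | exists (c : R -> CP H) (v : R -> R),
    [/\ c 0 = x, c 1 = y,
        forall t, t \in `[0, 1] -> has_FS_speed c t (v t)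
      & L = Rintegral lebesgue_measure `[0, 1] v]].

Definition FS_dist (x y : CP H) : R := inf (FS_lengths x y).

Definition FS_dist_set (x : CP H) (Y : set (CP H)) : R :=
  inf [set FS_dist x y | y in Y].

End HilbertSpace.

(* Main.v *)
(* The squared transition probability F = |<y, c t>|^2 along a C^1 curve c of Fubini-Study
   speed v satisfies |F'| <= 2 sqrt (F (1 - F)) v, that is, theta = acos (sqrt F) satisfies
   |theta'| <= v away from the singularities F = 0 and F = 1; hence a curve from x to y has
   length at least acos |<x, y>|, with equality for the great circle through aligned unit
   representatives. To stay clear of the singularities, 2 F - 1 = cos (2 theta) is replaced
   by l (2 F - 1) with l < 1, and l tends to 1 at the end.
   For a projection E and phi in Ran E, |<psi, phi>| = |<E psi, phi>| <= |E psi|, with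
   equality at phi = E psi / |E psi|; so the distance to pi' E is acos |E psi|. *)
Require Import Defs.
From mathcomp Require Import all_boot all_order all_algebra.
From mathcomp Require Import sesquilinear complex.
From mathcomp Require Import generic_quotient ring lra.
From mathcomp Require Import all_classical all_reals all_analysis.

Import Order.TTheory GRing.Theory Num.Theory.
Import numFieldNormedType.Exports.

Local Open Scope classical_set_scope.
Local Open Scope ring_scope.

(** * Real inner products, Cauchy-Schwarz and horizontal parts *)

Section RealInner.
Local Open Scope complex_scope.
Context {R : realType} {H : normedModType R[i]}.
Implicit Types (a : R) (u v w : H) (psi phi : sphere H).

Lemma rnormE u : `|u| = (rnorm u)%:C.
Proof. by rewrite /rnorm RRe_real// normr_real. Qed.

Lemma rnorm_ge0 u : 0 <= rnorm u.
Proof. by rewrite -ler0c -rnormE. Qed.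

Lemma rnorm_eq0 u : (rnorm u == 0) = (u == 0).
Proof. by rewrite -(inj_eq (@complexI R)) -rnormE normr_eq0. Qed.

Lemma rnorm_sphere psi : rnorm psi = 1.
Proof. by apply: complexI; rewrite -rnormE (eqP (sphereP psi)). Qed.

Lemma scale_iK u : 'i *: ('i *: u) = - u.
Proof. by rewrite scalerA -expr2 sqr_i scaleN1r. Qed.

Lemma scale_iZ a u : 'i *: (a%:C *: u) = a%:C *: ('i *: u).
Proof. by rewrite !scalerA mulrC. Qed.

Lemma complex_scale (z : R[i]) u :
  z *: u = (complex.Re z)%:C *: u + (complex.Im z)%:C *: ('i *: u).
Proof. by rewrite {1}(complexE z) scalerDl scalerA [_ * 'i]mulrC. Qed.

Variable dot : {dot H for @Num.conj R[i]}.

(* Multiplication by ['i] turns <u, v> into a pair of real inner products: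
   <u, v> = rip u v - rip u ('i v) 'i. *)
Definition rip u v : R := complex.Re (inner dot u v).

(* |<u, v>|^2 *)
Definition overlap u v : R := rip u v ^+ 2 + rip u ('i *: v) ^+ 2.

Lemma ripDl u v w : rip (u + v) w = rip u w + rip v w.
Proof. by rewrite /rip /inner linearDr raddfD. Qed.

Lemma ripDr u v w : rip w (u + v) = rip w u + rip w v.
Proof. by rewrite /rip /inner linearDl raddfD. Qed.

Lemma ripZr a u v : rip u (a%:C *: v) = a * rip u v.
Proof. by rewrite /rip /inner linearZl_LR /=; case: (dot _ _) => x y /=; ring. Qed.

Lemma innerC u v : inner dot u v = (inner dot v u)^*.
Proof. by rewrite /inner hermC/= expr0 mul1r. Qed.

Lemma inner_ir u v : inner dot u ('i *: v) = 'i * inner dot u v.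
Proof. by rewrite /inner linearZl_LR. Qed.

Lemma ripC u v : rip u v = rip v u.
Proof. by rewrite /rip innerC; case: (inner _ _ _). Qed.

Lemma ripZl a u v : rip (a%:C *: u) v = a * rip u v.
Proof. by rewrite ripC ripZr ripC. Qed.

Lemma ripNr u v : rip u (- v) = - rip u v.
Proof. by rewrite /rip /inner linearNl raddfN. Qed.

Lemma ripNl u v : rip (- u) v = - rip u v.
Proof. by rewrite ripC ripNr ripC. Qed.

Lemma Im_inner u v : complex.Im (inner dot u v) = - rip u ('i *: v).
Proof. by rewrite /rip inner_ir; case: (inner _ _ _) => x y /=; ring. Qed.

Lemma rip_il u v : rip ('i *: u) v = - rip u ('i *: v).
Proof.
rewrite ripC /rip !inner_ir innerC; case: (inner _ _ _) => x y /=; ring.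
Qed.

Lemma rip_i u v : rip ('i *: u) ('i *: v) = rip u v.
Proof. by rewrite rip_il scale_iK ripNr opprK. Qed.

Lemma rip_self_i u : rip u ('i *: u) = 0.
Proof. by have := rip_il u u; rewrite ripC => ?; lra. Qed.

(** Splits the complex coefficient into two real ones, the form to which [ripE] applies. *)
Lemma horizontalE psi v :
  horizontal dot psi v =
    v - ((rip psi v)%:C *: (psi : H) + (- rip psi ('i *: v))%:C *: ('i *: (psi : H))).
Proof. by rewrite /horizontal complex_scale Im_inner. Qed.

Lemma overlapE u v : (overlap u v)%:C = `|inner dot u v| ^+ 2.
Proof. by rewrite -add_Re2_Im2 Im_inner sqrrN. Qed.

Lemma overlap_ge0 u v : 0 <= overlap u v.
Proof. by rewrite addr_ge0 ?sqr_ge0. Qed.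

Lemma overlapC u v : overlap u v = overlap v u.
Proof. by rewrite /overlap ripC (ripC u) rip_il sqrrN. Qed.

Lemma overlap_phase (z : R[i]) u v : `|z| = 1 -> overlap u (z *: v) = overlap u v.
Proof.
move=> z1; apply: complexI; rewrite !overlapE /inner linearZl_LR /=.
by rewrite normrM z1 mul1r.
Qed.

Lemma overlapZ a u v : overlap u (a%:C *: v) = a ^+ 2 * overlap u v.
Proof.
rewrite /overlap scalerA mulrC -scalerA !ripZr; ring.
Qed.

Hypothesis dot_norm : inner_norm dot.

Lemma rip_self u : rip u u = rnorm u ^+ 2.
Proof. by rewrite /rip -dot_norm rnormE -rmorphXn. Qed.

(** Expands the real inner product of real combinations of vectors and of their multiples by ['i],
    so that [ring] can conclude. *)
Definition ripE := (@scalerDr R[i] H, scale_iZ, @scalerN R[i] H, scale_iK,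
  ripDl, ripDr, ripZl, ripZr, ripNl, ripNr, rip_i, rip_il, rip_self_i).

Lemma rip_CauchySchwarz u v : rip u v ^+ 2 <= rnorm u ^+ 2 * rnorm v ^+ 2.
Proof.
have [v0|v0] := eqVneq (rnorm v) 0.
  have -> : v = 0 by apply/eqP; rewrite -rnorm_eq0 v0.
  by rewrite -(scale0r v) (ripZr 0) mul0r expr0n mulr_ge0 ?sqr_ge0.
have v2_gt0 : 0 < rnorm v ^+ 2 by rewrite exprn_even_gt0.
(* [a v] is the real projection of [u] on [v]; the squared norm of [u - a v], times that of [v], is
   the difference of the two sides. *)
pose a := rip u v / rnorm v ^+ 2.
have aE : a * rnorm v ^+ 2 = rip u v by rewrite /a divfK ?gt_eqF.
have := sqr_ge0 (rnorm (u + (- a)%:C *: v)).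
rewrite -[X in 0 <= X -> _]rip_self !ripE !rip_self (ripC v u) => h; rewrite -subr_ge0.

suff <- : (rnorm u ^+ 2 - 2 * a * rip u v + a * (a * rnorm v ^+ 2)) * rnorm v ^+ 2
    = rnorm u ^+ 2 * rnorm v ^+ 2 - rip u v ^+ 2.
  rewrite mulr_ge0 ?(ltW v2_gt0)//; move: h; congr (0 <= _); ring.
rewrite -[in RHS]aE -[in LHS]aE; ring.
Qed.

(** Pythagoras: the component of [v] along the complex line of the unit vector [psi] has squared
    norm [overlap psi v]. *)
Lemma rnorm_horizontal psi v :
  rnorm (horizontal dot psi v) ^+ 2 = rnorm v ^+ 2 - overlap psi v.
Proof.
rewrite -[LHS]rip_self horizontalE /overlap !ripE !rip_self rnorm_sphere.
rewrite (ripC v psi) (ripC v ('i *: _)) rip_il; ring.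
Qed.

Lemma overlap_le u v : overlap u v <= rnorm u ^+ 2 * rnorm v ^+ 2.
Proof.
(* Cauchy-Schwarz for [<v, u> *: v] *)
have [u0|u0] := eqVneq (overlap u v) 0; first by rewrite u0 mulr_ge0 ?sqr_ge0.
have u_gt0 : 0 < overlap u v by rewrite lt_neqAle eq_sym u0 overlap_ge0.
pose w := (rip u v)%:C *: v + (rip u ('i *: v))%:C *: ('i *: v).
have := rip_CauchySchwarz u w; rewrite -(rip_self w) /w !ripE !rip_self.
rewrite -!expr2 -/(overlap u v) [X in _ * X](_ : _ = overlap u v * rnorm v ^+ 2);
  last by rewrite /overlap; ring.
by rewrite mulrCA expr2 ler_pM2l.
Qed.

(* With f = <phi, g> and F = |f|^2, the derivative of F along w is 2 Re <q, w>
   for q = f phi - F g; as q is orthogonal to g over C, only the horizontal part of w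
   matters, and |q|^2 = F (1 - F). *)
Lemma overlap_deriv_bound psi phi w : rip psi w = 0 ->
  (rip phi psi * rip phi w + rip phi ('i *: (psi : H)) * rip phi ('i *: w)) ^+ 2 <=
  overlap phi psi * (1 - overlap phi psi) * rnorm (horizontal dot psi w) ^+ 2.
Proof.
move=> pw.
pose F := overlap phi psi; have FE : F = overlap phi psi by [].
pose q := (rip phi psi)%:C *: (phi : H) + (- rip phi ('i *: (psi : H)))%:C *: ('i *: (phi : H))
  + (- F)%:C *: (psi : H).
have qE : rnorm q ^+ 2 = F * (1 - F).
  rewrite -rip_self /q !ripE !rip_self !rnorm_sphere (ripC psi phi).
  rewrite (ripC psi ('i *: _)) !ripE.
  by rewrite FE /overlap; ring.
have := rip_CauchySchwarz q (horizontal dot psi w); rewrite qE; congr (_ ^+ 2 <= _).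
rewrite horizontalE /q !ripE !rip_self !rnorm_sphere pw FE /overlap; ring.
Qed.

End RealInner.

(** * Limits and derivatives of vector-valued functions *)

Section Limits.
Local Open Scope complex_scope.
Context {R : realType} {H : normedModType R[i]}.
Implicit Types (a : R) (u v w : H) (psi phi : sphere H).

Lemma rnormD u v : rnorm (u + v) <= rnorm u + rnorm v.
Proof. by rewrite -lecR rmorphD /= -!rnormE ler_normD. Qed.

Lemma rnormZ a u : rnorm (a%:C *: u) = `|a| * rnorm u.
Proof. 
apply: complexI; rewrite rmorphM /= -!rnormE normrZ; congr (_ * _).
by rewrite normc_def /= expr0n /= addr0 sqrtr_sqr.
Qed.

(** The norm of [H] has values in [R[i]]; this reduces convergence in [H] to a limit in [R]. *)
Lemma cvg_rnormP {T : Type} {F : set_system T} {FF : Filter F} (f : T -> H) v :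
  f @ F --> v <-> rnorm (v - f x) @[x --> F] --> 0.
Proof.
split.
  move=> /cvgrPdist_lt fv; apply/cvgr0Pnorm_lt => e e0.
  have e0' : 0 < e%:C :> R[i] by rewrite ltcR.
  have := fv _ e0'; apply: filterS => x.
  by rewrite rnormE ltcR ger0_norm// rnorm_ge0.
move=> /cvgr0Pnorm_lt fv; apply/cvgrPdist_lt => e e0.
have eE : e = (complex.Re e)%:C by rewrite RRe_real// gtr0_real.
have := fv (complex.Re e); rewrite -ltcR -eE => /(_ e0).
by apply: filterS => x; rewrite ger0_norm ?rnorm_ge0// rnormE eE ltcR.
Qed.

Lemma cvg_rnorm {T : Type} {F : set_system T} {FF : Filter F} (f : T -> H) v :
  f @ F --> v -> rnorm (f x) @[x --> F] --> rnorm v.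
Proof.
move=> /cvg_rnormP/cvgr0Pnorm_lt fv; apply/cvgrPdist_lt => e /fv.
apply: filterS => x; apply: le_lt_trans; rewrite (ger0_norm (rnorm_ge0 _)).
have rB : rnorm (f x - v) = rnorm (v - f x) by rewrite /rnorm distrC.
have := rnormD (v - f x) (f x); have := rnormD (f x - v) v.
by rewrite !subrK rB ler_norml => ? ?; apply/andP; split; lra.
Qed.

Variable dot : {dot H for @Num.conj R[i]}.
Hypothesis dot_norm : inner_norm dot.

(** Polarization, from which [rip] inherits the continuity of the norm. *)
Lemma rip_polar u v : rip dot u v = 4^-1 * (rnorm (u + v) ^+ 2 - rnorm (u - v) ^+ 2).
Proof.
rewrite -!(rip_self _ dot_norm) !ripE (ripC dot v u); by field.
Qed.

Lemma cvg_rip {T : Type} {F : set_system T} {FF : Filter F} (f g : T -> H) u v :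
  f @ F --> u -> g @ F --> v -> rip dot (f x) (g x) @[x --> F] --> rip dot u v.
Proof.
move=> fu gv; rewrite rip_polar.
under eq_fun do rewrite rip_polar.
apply: cvgMl_tmp; apply: cvgB; under eq_fun do rewrite expr2; rewrite expr2; apply: cvgM;
  apply: cvg_rnorm; by [exact: cvgD|exact: cvgB].
Qed.

Lemma cvg_overlap {T : Type} {F : set_system T} {FF : Filter F} (f g : T -> H) u v :
  f @ F --> u -> g @ F --> v -> overlap dot (f x) (g x) @[x --> F] --> overlap dot u v.
Proof.
move=> fu gv; rewrite /overlap !expr2; under eq_fun do rewrite !expr2.
have iv : 'i *: g x @[x --> F] --> 'i *: v by exact: cvgZl_tmp.
by apply: cvgD; apply: cvgM; exact: cvg_rip.
Qed.

Lemma is_rderive_continuous (g : R -> H) t w : is_rderive g t w -> {for t, continuous g}.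
Proof.
move=> gw; apply/cvg_rnormP.
suff : {for t, continuous (fun r => rnorm (g t - g r))}.
  by rewrite /prop_for /continuous_at subrr [rnorm 0]/rnorm normr0.
apply/continuous_withinNshiftx; rewrite subrr.
(* For [h != 0] this product is the norm of [g (t + h) - g t], and its limit is 0. *)
have : `|h| * rnorm ((h^-1)%:C *: (g (t + h) - g t)) @[h --> (0 : R)^'] --> `|0 : R| * rnorm w.
  by apply: cvgM; [apply: cvg_norm; exact: cvg_within|exact: cvg_rnorm].
rewrite normr0 mul0r [rnorm 0]/rnorm normr0; apply: cvg_trans; apply: near_eq_cvg.
near=> h.
have hn0 : h != 0 by near: h; exact: nbhs_dnbhs_neq.
rewrite -rnormZ scalerA -rmorphM mulfV// scale1r /= (addrC h).
by rewrite /rnorm distrC.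
Unshelve. all: by end_near. Qed.

Lemma is_rderive_rip (g : R -> H) t u w : is_rderive g t w ->
  is_derive t 1 (fun r => rip dot u (g r)) (rip dot u w).
Proof.
move=> gw.
have : h^-1 *: (rip dot u (g (h *: 1 + t)) - rip dot u (g t)) @[h --> (0:R)^'] --> rip dot u w.
  have : rip dot u ((h^-1)%:C *: (g (t + h) - g t)) @[h --> 0^'] --> rip dot u w.
    by apply: cvg_rip => //; exact: cvg_cst.
  apply: cvg_trans; apply: near_eq_cvg; near=> h.
  by rewrite !ripE [h *: 1]mulr1 (addrC h).
move=> D; apply: DeriveDef; first by apply/cvg_ex; exists (rip dot u w).
exact: cvg_lim.
Unshelve. all: by end_near. Qed.

End Limits.

(** * Transition probability and speed along C^1 curves of CP(H) *)

Section Curves.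
Local Open Scope complex_scope.
Context {R : realType} {H : normedModType R[i]}.
Implicit Types (psi phi : sphere H) (x y : CP H) (c : R -> CP H) (t : R).

Lemma pi2P psi phi :
  pi2 psi = pi2 phi <-> exists2 z : R[i], `|z| = 1 & phi = z *: (psi : H) :> H.
Proof. by split => [/eqmodP/asboolP|h]; last by apply/eqmodP/asboolP. Qed.

Lemma pi2_repr x : pi2 (repr x) = x.
Proof. exact: reprK. Qed.

Variable dot : {dot H for @Num.conj R[i]}.
Hypothesis dot_norm : inner_norm dot.

(** The transition probability of two points. Phases do not affect [overlap], so [cp_overlapE]
    allows any unit representatives. *)
Definition cp_overlap x y : R := overlap dot (repr x) (repr y).

Lemma cp_overlapE psi phi : cp_overlap (pi2 psi) (pi2 phi) = overlap dot psi phi.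
Proof.
have E u phi' : overlap dot u (repr (pi2 phi')) = overlap dot u phi'.
  by have /pi2P[z z1 ->] := pi2_repr (pi2 phi'); rewrite overlap_phase.
by rewrite /cp_overlap E overlapC E overlapC.
Qed.

Lemma cp_overlap_ge0 x y : 0 <= cp_overlap x y.
Proof. exact: overlap_ge0. Qed.

Lemma cp_overlap_le1 x y : cp_overlap x y <= 1.
Proof.
by apply: le_trans (overlap_le _ dot_norm _ _) _; rewrite !rnorm_sphere expr1n mulr1.
Qed.

Lemma cp_overlap_self x : cp_overlap x x = 1.
Proof.
by rewrite /cp_overlap /overlap rip_self// rip_self_i rnorm_sphere; ring.
Qed.

(* The Fubini-Study speed depends on the curve only: its square is
   lim_h (1 - |<c t, c (t + h)>|^2) / h^2, whatever the lift. *)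
Lemma C1_lift_speed_cvg {c t} {g : R -> sphere H} {dg : R -> H} : C1_lift c t g dg ->
  h^-1 ^+ 2 * (1 - cp_overlap (c t) (c (t + h))) @[h --> (0 : R)^'] -->
  rnorm (horizontal dot (g t) (dg t)) ^+ 2.
Proof.
move=> cg; have [gt dgt _] := nbhs_singleton cg.
pose q h : H := (h^-1)%:C *: ((g (t + h) : H) - (g t : H)).
have : rnorm (q h) ^+ 2 - overlap dot (g t) (q h) @[h --> (0 : R)^'] -->
    rnorm (dg t) ^+ 2 - overlap dot (g t) (dg t).
  apply: cvgB; last by apply: cvg_overlap => //; exact: cvg_cst.
  rewrite expr2; under eq_fun do rewrite expr2.
  by apply: cvgM; exact: cvg_rnorm.
rewrite rnorm_horizontal//; apply: cvg_trans; apply: near_eq_cvg; near=> h.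
have gh : pi2 (g (t + h)) = c (t + h).
  near: h; apply: nbhs_dnbhs; move/nbhs0P: cg; apply: filterS => s; by case.
rewrite -gt -gh cp_overlapE /q rnormZ overlapZ exprMn real_normK ?num_real//.
rewrite -mulrBr; congr (_ * _).
(* For unit vectors with inner product [z], this is [2 - 2 Re z - |z - 1|^2 = 1 - |z|^2]. *)
rewrite -[in LHS](rip_self dot)// /overlap !ripE !rip_self// !rnorm_sphere.
rewrite (ripC dot _ (g t)); ring.
Unshelve. all: by end_near. Qed.

Lemma FS_speed_sqr_cvg {c t v} : has_FS_speed dot c t v ->
  h^-1 ^+ 2 * (1 - cp_overlap (c t) (c (t + h))) @[h --> (0 : R)^'] --> v ^+ 2.
Proof. by move=> [g [dg [cg ->]]]; exact: C1_lift_speed_cvg. Qed.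

Lemma FS_speed_ge0 {c t v} : has_FS_speed dot c t v -> 0 <= v.
Proof. by move=> [g [dg [_ ->]]]; exact: rnorm_ge0. Qed.

(** Both squares are the same limit, in which no lift occurs. This matters because a curve may come
    with a different lift at each time. *)
Lemma FS_speed_unique {c t v w} : has_FS_speed dot c t v -> has_FS_speed dot c t w -> v = w.
Proof.
move=> cv cw; apply/eqP; rewrite -(@eqrXn2 _ 2%N) ?(FS_speed_ge0 cv) ?(FS_speed_ge0 cw)//.
by apply/eqP; exact: (cvg_unique (@Rhausdorff R) (FS_speed_sqr_cvg cv) (FS_speed_sqr_cvg cw)).
Qed.

Lemma C1_lift_near {c t} {g : R -> sphere H} {dg : R -> H} : C1_lift c t g dg ->
  \forall s \near t, has_FS_speed dot c s (rnorm (horizontal dot (g s) (dg s))).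
Proof.
by move=> /near_join; apply: filterS => s cs; exists g, dg; split.
Qed.

Lemma C1_lift_cvg {c t} {g : R -> sphere H} {dg : R -> H} : C1_lift c t g dg ->
  ((g s : H) @[s --> t] --> (g t : H)) /\ (dg s @[s --> t] --> dg t).
Proof.
by move=> /nbhs_singleton[_ gt dgt]; split => //; exact: is_rderive_continuous gt.
Qed.

(** By uniqueness, near [t] the speed is the one given by the lift chosen at [t], which is
    continuous. *)
Lemma FS_speed_continuous c (v : R -> R) :
  (forall t, t \in `[0, 1] -> has_FS_speed dot c t (v t)) ->
  {within `[0, 1], continuous v}.
Proof.
move=> cv; apply/subspace_continuousP => t t01.
have [g [dg [cg vt]]] := cv _ t01.
have [gt dgt] := C1_lift_cvg cg.
have : rnorm (horizontal dot (g s) (dg s)) @[s --> t] --> v t.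
  have hE s : rnorm (horizontal dot (g s) (dg s)) =
      Num.sqrt (rnorm (dg s) ^+ 2 - overlap dot (g s) (dg s)).
    by rewrite -rnorm_horizontal// sqrtr_sqr ger0_norm// rnorm_ge0.
  rewrite vt hE; under eq_fun do rewrite hE.
  apply: cvg_comp; last exact: sqrt_continuous.
  apply: cvgB; last exact: cvg_overlap.
  rewrite expr2; under eq_fun do rewrite expr2.
  by apply: cvgM; exact: cvg_rnorm.
move=> /(cvg_within_filter `[0, 1]); apply: cvg_trans; apply: near_eq_cvg.
apply: filterS (C1_lift_near cg) => s hs s01.
by rewrite (FS_speed_unique hs (cv s s01)).
Qed.

Lemma C1_lift_tangent c t (g : R -> sphere H) dg : C1_lift c t g dg ->
  rip dot (g t) (dg t) = 0.
Proof.
move=> /nbhs_singleton[_ gt _].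
pose q h : H := (h^-1)%:C *: ((g (t + h) : H) - (g t : H)).
have qt : q h @[h --> (0 : R)^'] --> dg t by [].
(* As [g t] and [g (t + h)] are unit vectors, Re <g t, q h> equals [- h / 2] times the squared norm
   of [q h], which tends to 0. *)
have : - 2^-1 * (h * rnorm (q h) ^+ 2) @[h --> (0 : R)^'] -->
    - 2^-1 * (0 * rnorm (dg t) ^+ 2).
  apply: cvgMl_tmp; rewrite expr2; under eq_fun do rewrite expr2.
  apply: cvgM; first exact: cvg_within.
  by apply: cvgM; exact: cvg_rnorm.
rewrite mul0r mulr0 => z; apply: (cvg_unique (@Rhausdorff R) _ z).
have : rip dot (g t) (q h) @[h --> (0 : R)^'] --> rip dot (g t) (dg t).
  by apply: cvg_rip => //; exact: cvg_cst.
apply: cvg_trans; apply: near_eq_cvg; near=> h.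
have hn0 : h != 0 by near: h; exact: nbhs_dnbhs_neq.
rewrite -(rip_self dot)// /q !ripE !rip_self// !rnorm_sphere (ripC dot _ (g t)).
by field.
Unshelve. all: by end_near. Qed.

(** The directional derivative of |<phi, .>|^2 at [psi] along [w]. *)
Definition overlap_deriv phi psi (w : H) : R :=
  2 * (rip dot phi psi * rip dot phi w + rip dot phi ('i *: (psi : H)) * rip dot phi ('i *: w)).

Lemma is_rderive_i (g : R -> H) t w : is_rderive g t w ->
  is_rderive (fun r => 'i *: g r) t ('i *: w).
Proof.
move=> gw; have : 'i *: ((h^-1)%:C *: (g (t + h) - g t)) @[h --> (0 : R)^'] --> 'i *: w.
  exact: cvgZl_tmp.
by apply: cvg_trans; apply: near_eq_cvg; near=> h; rewrite scale_iZ scalerBr.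
Unshelve. all: by end_near. Qed.

Lemma is_derive_cp_overlap phi c t (g : R -> sphere H) dg : C1_lift c t g dg ->
  is_derive t 1 (fun r => cp_overlap (pi2 phi) (c r)) (overlap_deriv phi (g t) (dg t)).
Proof.
move=> cg; have [_ gt _] := nbhs_singleton cg.
have D1 := is_rderive_rip _ dot_norm _ _ phi _ gt.
have D2 := is_rderive_rip _ dot_norm _ _ phi _ (is_rderive_i _ _ _ gt).
have D : is_derive t 1 (fun r => overlap dot phi (g r)) (overlap_deriv phi (g t) (dg t)).
  by apply: is_derive_eq; rewrite /overlap_deriv /GRing.scale /=; ring.
apply: near_eq_is_derive D.
by apply: filterS cg => s [<- _ _]; rewrite cp_overlapE.
Qed.

Lemma overlap_deriv_continuous phi c t (g : R -> sphere H) dg : C1_lift c t g dg ->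
  {for t, continuous (fun s => overlap_deriv phi (g s) (dg s))}.
Proof.
move=> cg; have [gt dgt] := C1_lift_cvg cg.
have [igt idgt] : ('i *: (g s : H) @[s --> t] --> 'i *: (g t : H)) /\
  ('i *: dg s @[s --> t] --> 'i *: dg t) by split; exact: cvgZl_tmp.
rewrite /prop_for /continuous_at /overlap_deriv; apply: cvgMl_tmp.
by apply: cvgD; apply: cvgM; apply: cvg_rip => //; exact: cvg_cst.
Qed.

End Curves.

(** * From the differential inequality to a bound on the angle *)

Section Angle.
Context {R : realType}.
(** For [l = 1] the left side of the hypothesis would be [2 acos (sqrt F)]. The passage to the limit
    is done by contradiction, with one [l] close enough to 1. *)
Lemma acos_sqrt_le_of_asin (F L : R) : 0 <= F <= 1 -> 0 <= L ->
  (forall l : R, 0 < l < 1 -> asin l - asin (l * (2 * F - 1)) <= 2 * L) ->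
  acos (Num.sqrt F) <= L.
Proof.
move=> /andP[F0 F1] L0 hL; rewrite leNgt; apply/negP => LB.
set B := acos _ in LB.
have sF : Num.sqrt F \in `[(-1), 1].
  rewrite in_itv/= (le_trans _ (sqrtr_ge0 _)) ?lerN10//=.
  by rewrite -[leRHS]sqrtr1 ler_sqrt ?ltr01.
have pi_gt0 := pi_gt0 R.
have B0 : 0 <= B by exact: acos_ge0.
have cB : cos B = Num.sqrt F by rewrite acosK.
have Bpi : B <= pi by exact: acos_lepi.
have B2 : B <= pi / 2.
  by rewrite leNgt -ltr_cos ?in_itv/= ?cos_pihalf ?cB -?leNgt ?sqrtr_ge0//; lra.
pose u := 2 * F - 1.
have cBu : cos (2 * B) = u.
  by rewrite mulrC mulr_natr cos_mulr2n cB sqr_sqrtr// /u; ring.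
have uL : u < cos (2 * L).
  by rewrite -cBu ltr_cos ?in_itv/=; lra.
(* With [l ^+ 2 = 1 - s ^+ 2], the cosine of [asin l - asin (l * u)] is at most [u + 2 s], hence
   less than [u + 3 s <= cos (2 * L)]. The bound 1/2 keeps [l] positive. *)
pose s := Num.min ((cos (2 * L) - u) / 3) (1 / 2).
have s0 : 0 < s by rewrite lt_min; apply/andP; split; lra.
have [sD s2] : s <= (cos (2 * L) - u) / 3 /\ s <= 1 / 2.
  by split; rewrite ge_min lexx ?orbT.
have s21 : 0 < 1 - s ^+ 2 < 1 by rewrite expr2; nra.
pose l := Num.sqrt (1 - s ^+ 2).
have lE : l ^+ 2 = 1 - s ^+ 2 by rewrite sqr_sqrtr//; lra.
have l0 : 0 < l by rewrite sqrtr_gt0; lra.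
have l1 : l < 1 by rewrite -[ltRHS]sqrtr1 ltr_sqrt; lra.
have lu : -1 <= l * u <= 1.
  by apply/andP; split; rewrite /u; nra.
have := hL l; rewrite l0 l1 -/u => /(_ isT) ab.
(* So the difference of the angles lies in [0, pi], where the cosine decreases. *)
have abge : asin (l * u) <= asin l.
  have l01 : -1 <= l <= 1 by lra.
  have [? ? ? ?] := And4 (asin_geNpi2 l01) (asin_lepi2 l01) (asin_geNpi2 lu) (asin_lepi2 lu).
  rewrite leNgt -ltr_sin ?in_itv/= ?asinK ?in_itv/= -?leNgt//; first by rewrite /u; nra.
  - by apply/andP.
  - by apply/andP.
have : cos (2 * L) <= cos (asin l - asin (l * u)).
  by rewrite leNgt ltr_cos ?in_itv/= -?leNgt; lra.
rewrite cosB !cos_asin ?asinK ?in_itv/=; [|lra..].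
have -> : 1 - l ^+ 2 = s ^+ 2 by lra.
rewrite sqrtr_sqr gtr0_norm// mulrA -expr2 lE.
set w := Num.sqrt (_ - _).
have w1 : w <= 1.
  rewrite -[leRHS]sqrtr1 ler_sqrt ?ltr01// lerBlDr lerDl sqr_ge0//.
have w0 : 0 <= w by exact: sqrtr_ge0.
have : s * w <= s by rewrite ger_pMr.
have : - (s ^+ 2) * u <= s.
  rewrite expr2 /u; nra.
lra.
Qed.

Local Notation mu := (@lebesgue_measure R).

(* If cos theta = 2 F - 1 then the bound on dF reads |theta'| <= 2 v; the
   factor l < 1 keeps asin differentiable, and |(asin (l cos theta))'| <= |theta'| because
   l^2 (1 - cos^2 theta) <= 1 - l^2 cos^2 theta. *)
Lemma asin_increment_le_integral (F dF v : R -> R) (l : R) :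
  0 < l < 1 -> (forall t : R, t \in `[0, 1] -> 0 <= F t <= 1) ->
  (forall t : R, t \in `[0, 1] -> is_derive t 1 F (dF t)) ->
  {within `[0, 1], continuous dF} -> {within `[0, 1], continuous v} ->
  (forall t : R, t \in `[0, 1] -> 0 <= v t) ->
  (forall t : R, t \in `[0, 1] -> dF t ^+ 2 <= 4 * (F t * (1 - F t)) * v t ^+ 2) ->
  asin (l * (2 * F 1 - 1)) - asin (l * (2 * F 0 - 1)) <=
    2 * Rintegral mu `[0, 1] v.
Proof.
move=> /andP[l0 l1] F01 FdF cdF cv v0 dFv.
pose w (t : R) := l * (2 * F t - 1).
have w1 (t : R) : t \in `[0, 1] -> -1 < w t < 1.
  by move=> /F01/andP[? ?]; rewrite /w; apply/andP; split; nra.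
pose k (t : R) := asin (w t).
pose f (t : R) := (Num.sqrt (1 - w t ^+ 2))^-1 * (l * (2 * dF t)).
have wd (t : R) : t \in `[0, 1] -> is_derive t 1 w (l * (2 * dF t)).
  move=> t01; have FdFt := FdF t t01.
  by apply: is_derive_eq; rewrite /GRing.scale /=; ring.
have wc (t : R) : t \in `[0, 1] -> {for t, continuous w}.
  by move=> /wd[? _]; exact/differentiable_continuous/derivable1_diffP.
have kf (t : R) : t \in `[0, 1] -> is_derive t 1 k (f t).
  by move=> t01; exact: is_derive1_comp (is_derive1_asin (w1 t t01)) (wd t t01).
have sq0 (t : R) : t \in `[0, 1] -> 0 < 1 - w t ^+ 2.
  by move=> /w1/andP[? ?]; rewrite expr2; nra.
have kc (t : R) : t \in `[0, 1] -> {for t, continuous k}.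
  by move=> /kf[? _]; exact/differentiable_continuous/derivable1_diffP.
have cf : {within `[0, 1], continuous f}.
  apply/subspace_continuousP => t t01; apply: cvgM.
    apply: cvgV; first by rewrite gt_eqF// sqrtr_gt0 sq0.
    apply: cvg_within_filter.
    apply: continuous_comp; last exact: sqrt_continuous.
    apply: cvgB; first exact: cvg_cst.
    by rewrite expr2; under eq_fun do rewrite expr2; apply: cvgM; exact: wc.
  apply: cvgMl_tmp; apply: cvgMl_tmp.
  by move/subspace_continuousP: cdF; exact.
have fv (t : R) : t \in `[0, 1] -> f t <= 2 * v t.
  move=> t01; rewrite /f mulrC ler_pdivrMr ?sqrtr_gt0 ?sq0//.
  apply: le_trans (ler_norm _) _.
  rewrite -(@ler_pXn2r _ 2) ?nnegrE ?normr_ge0 ?mulr_ge0 ?v0 ?sqrtr_ge0//.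
  rewrite real_normK ?num_real// [leRHS]exprMn sqr_sqrtr ?(ltW (sq0 t t01))// !exprMn.
  have := dFv t t01; have := F01 t t01; move: (dF t ^+ 2) (v t ^+ 2) (sqr_ge0 (v t)).
  move=> d V V0 /andP[? ?] dV.
  have : l ^+ 2 * (2 ^+ 2 * d) <= l ^+ 2 * (2 ^+ 2 * (4 * (F t * (1 - F t)) * V)).
    by rewrite ler_pM2l ?exprn_gt0// ler_pM2l.
  move=> /le_trans; apply; rewrite /w -subr_ge0.
  (* Uses [4 F (1 - F) = 1 - (2 F - 1)^2], that is, sin^2 = 1 - cos^2 for theta. *)
  rewrite (_ : _ - _ = 4 * V * (1 - l ^+ 2)); last by ring.
  by rewrite !mulr_ge0// subr_ge0 expr2; nra.
have [if1 iv] : mu.-integrable `[0, 1] (EFin \o f) /\ mu.-integrable `[0, 1] (EFin \o v).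
  by split; apply: continuous_compact_integrable => //; exact: segment_compact.
rewrite (_ : asin _ - asin _ = Rintegral mu `[0, 1] f); last first.
  rewrite /Rintegral (@continuous_FTC2 _ f k) ?ltr01//.
    split; first by move=> t /subset_itv_oo_cc t01; have [] := kf t t01.
      by apply: cvg_at_right_filter; apply: kc; rewrite in_itv/= lexx ler01.
    by apply: cvg_at_left_filter; apply: kc; rewrite in_itv/= lexx ler01.
  by move=> t /subset_itv_oo_cc t01; have [_] := kf t t01; rewrite derive1E.
rewrite -RintegralZl//; apply: le_Rintegral => //.
by apply: eq_integrable (integrableZl _ 2 iv) => //.
Qed.

(** As [F 1 = 1], the increment of [asin (l (2 F - 1))] is exactly the expression bounded in
    [acos_sqrt_le_of_asin]. *)
Lemma acos_sqrt_le_integral (F dF v : R -> R) :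
  (forall t : R, t \in `[0, 1] -> 0 <= F t <= 1) ->
  (forall t : R, t \in `[0, 1] -> is_derive t 1 F (dF t)) ->
  {within `[0, 1], continuous dF} -> {within `[0, 1], continuous v} ->
  (forall t : R, t \in `[0, 1] -> 0 <= v t) ->
  (forall t : R, t \in `[0, 1] -> dF t ^+ 2 <= 4 * (F t * (1 - F t)) * v t ^+ 2) ->
  F 1 = 1 -> acos (Num.sqrt (F 0)) <= Rintegral mu `[0, 1] v.
Proof.
move=> F01 FdF cdF cv v0 dFv F1; apply: acos_sqrt_le_of_asin.
- by apply: F01; rewrite in_itv/= lexx ler01.
- by apply: Rintegral_ge0 => t; exact: v0.
move=> l l01; have := asin_increment_le_integral _ _ _ _ l01 F01 FdF cdF cv v0 dFv.
by rewrite F1 (_ : 2 * 1 - 1 = 1) ?mulr1//; lra.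
Qed.

End Angle.

(** * Derivatives of sums and of real multiples of a fixed vector *)

Section Rderive.
Local Open Scope complex_scope.
Context {R : realType} {H : normedModType R[i]}.

Lemma is_rderiveD (f g : R -> H) t u v : is_rderive f t u -> is_rderive g t v ->
  is_rderive (fun r => f r + g r) t (u + v).
Proof.
move=> fu gv; rewrite /is_rderive; apply: cvg_trans (cvgD fu gv); apply: near_eq_cvg.
by near=> h; rewrite [LHS]/GRing.add /=; rewrite -scalerDr opprD addrACA.
Unshelve. all: by end_near. Qed.

Lemma is_rderive_scale (f : R -> R) (t df : R) (u : H) : is_derive t 1 f df ->
  is_rderive (fun r => (f r)%:C *: u) t (df%:C *: u).
Proof.
move=> [fd <-]; apply/cvg_rnormP.
have : h^-1 *: ((f \o shift t) (h *: 1) - f t) @[h --> (0 : R)^'] --> 'D_1 f t.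
  exact: fd.
move=> fc.
have : `|'D_1 f t - h^-1 *: ((f \o shift t) (h *: 1) - f t)| * rnorm u @[h --> (0 : R)^'] -->
  `|'D_1 f t - 'D_1 f t| * rnorm u.
  by apply: cvgMr_tmp; apply: cvg_norm; apply: cvgB => //; exact: cvg_cst.
rewrite subrr normr0 mul0r; apply: cvg_trans; apply: near_eq_cvg; near=> h.
rewrite -rnormZ /= [h *: 1]mulr1 (addrC h) [_ *: (_ - _)]/GRing.scale /=.
by rewrite -scalerBl scalerA -scalerBl !rmorphB rmorphM rmorphB.
Unshelve. all: by end_near. Qed.

End Rderive.

(** * The Fubini-Study distance: lower bound and minimizing geodesics *)

Section Distance.
Local Open Scope complex_scope.
Context {R : realType} {H : normedModType R[i]}.
Implicit Types (psi phi : sphere H) (x y : CP H) (c : R -> CP H) (t : R).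
Variable dot : {dot H for @Num.conj R[i]}.
Hypothesis dot_norm : inner_norm dot.

Lemma cp_overlapC x y : cp_overlap dot x y = cp_overlap dot y x.
Proof. exact: overlapC. Qed.

Lemma FS_length_ge x y L : FS_lengths dot x y L -> acos (Num.sqrt (cp_overlap dot x y)) <= L.
Proof.
move=> [c [v [cx cy cv ->]]].
(* Measured from the endpoint [y], so that [F 1 = 1]. *)
pose F t := cp_overlap dot y (c t).
have FE : F = fun r => cp_overlap dot (pi2 (repr y)) (c r) by rewrite pi2_repr.
have lift t : t \in `[0, 1] -> exists (g : R -> sphere H) (dg : R -> H),
    [/\ C1_lift c t g dg, v t = rnorm (horizontal dot (g t) (dg t))
      & is_derive t 1 F (overlap_deriv dot (repr y) (g t) (dg t))].
  move=> t01; have [g [dg [cg vt]]] := cv t t01; exists g, dg; split => //.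
  by rewrite FE; exact: is_derive_cp_overlap.
rewrite -cx cp_overlapC -/(F 0).
(* The lift varies with [t], whereas [derive1 F] does not depend on it; its continuity at [t] is
   read off a single lift, valid near [t]. *)
apply: (@acos_sqrt_le_integral _ F (derive1 F) v).
- by move=> t _; rewrite cp_overlap_ge0 cp_overlap_le1.
- by move=> t /lift[g [dg [_ _ [Fd _]]]]; apply: DeriveDef => //; rewrite derive1E.
- apply/subspace_continuousP => t t01; apply: cvg_within_filter.
  have [g [dg [cg _ Ft]]] := lift t t01.
  have dFE : \forall s \near t, overlap_deriv dot (repr y) (g s) (dg s) = (derive1 F) s.
    move: cg => /near_join; apply: filterS => s cs.
    have := is_derive_cp_overlap dot dot_norm (repr y) _ _ _ _ cs.
    by rewrite -FE derive1E => -[_ ->].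
  have := overlap_deriv_continuous dot dot_norm (repr y) _ _ _ _ cg.
  rewrite /prop_for /continuous_at (nbhs_singleton dFE).
  by apply: cvg_trans; exact: near_eq_cvg.
- exact: FS_speed_continuous cv.
- by move=> t /cv; exact: FS_speed_ge0.
- move=> t /lift[g [dg [cg -> [_ Ft]]]]; rewrite derive1E Ft.
  have [gt _ _] := nbhs_singleton cg.
  have := overlap_deriv_bound dot dot_norm (g t) (repr y) _ (C1_lift_tangent _ dot_norm _ _ _ _ cg).
  rewrite -cp_overlapE gt pi2_repr -/(F t) /overlap_deriv => b.
  by rewrite exprMn; lra.
- by rewrite /F cy cp_overlap_self.
Qed.

(** The great circle from [psi] in the direction [e], orthogonal to [psi] over C, is horizontal of
    constant speed [th]. For [th = 0] it is constant, and [e] need not be a unit vector. *)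
Lemma geodesic_length psi phi (e : H) th : 0 <= th ->
  rip dot psi e = 0 -> rip dot psi ('i *: e) = 0 -> rnorm e = 1 \/ th = 0 ->
  phi = (cos th)%:C *: (psi : H) + (sin th)%:C *: e :> H ->
  FS_lengths dot (pi2 psi) (pi2 phi) th.
Proof.
move=> th0 pe pie eth phiE.
pose a t := cos (th * t); pose b t := sin (th * t).
(* Three identities that hold in both cases [rnorm e = 1] and [th = 0]: the curve stays on the
   sphere, its lift has speed [th], and its velocity is horizontal. *)
have ab t : a t ^+ 2 + b t ^+ 2 * rnorm e ^+ 2 = 1.
  case: eth => [->|th_0]; first by rewrite expr1n mulr1 cos2Dsin2.
  by rewrite /a /b th_0 !mul0r cos0 sin0 expr1n expr0n mul0r addr0.
have ba t : th ^+ 2 * (b t ^+ 2 + a t ^+ 2 * rnorm e ^+ 2) = th ^+ 2.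
  case: eth => [->|->]; first by rewrite expr1n mulr1 addrC cos2Dsin2 mulr1.
  by rewrite expr0n mul0r.
have aba t : th * (a t * b t * rnorm e ^+ 2) = th * (a t * b t).
  by case: eth => ->; rewrite ?mul0r// expr1n mulr1.
pose g0 t : H := (a t)%:C *: (psi : H) + (b t)%:C *: e.
have ep : rip dot e psi = 0 by rewrite ripC.
have eip : rip dot e ('i *: (psi : H)) = 0 by rewrite ripC rip_il pie oppr0.
have g1 t : `|g0 t| == 1.
  rewrite rnormE -[1]/(1%:C) (inj_eq (@complexI R)) -(@eqrXn2 _ 2%N) ?rnorm_ge0//.
  rewrite -(rip_self dot)// /g0 !ripE !rip_self// rnorm_sphere pe ep.
  by apply/eqP; rewrite expr1n; apply: etrans (ab t); ring.
pose g t := Sphere (g1 t).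
pose dg t : H := (- (th * b t))%:C *: (psi : H) + (th * a t)%:C *: e.
have gdg t : is_rderive (fun r => g r : H) t (dg t).
  apply: is_rderiveD; apply: is_rderive_scale.
    by rewrite /a; apply: is_derive_eq; rewrite /b /GRing.scale /=; ring.
  by rewrite /b; apply: is_derive_eq; rewrite /a /GRing.scale /=; ring.
exists (fun t => pi2 (g t)), (fun=> th); split.
- by apply/pi2P; exists 1; rewrite ?normr1// scale1r /= /g0 /a /b mulr0 cos0 sin0
    scale1r scale0r addr0.
- by congr pi2; apply: val_inj; rewrite /= /g0 /a /b mulr1.
- move=> t _; exists g, dg; split.
    rewrite /C1_lift; apply: filterE => s; split => //; rewrite /dg.
    apply: is_rderive_continuous; apply: is_rderiveD; apply: is_rderive_scale;
      apply: derivableP; rewrite /a /b; exact: ex_derive.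
  rewrite -[LHS]ger0_norm// -[RHS]ger0_norm ?rnorm_ge0// -!sqrtr_sqr; congr Num.sqrt.
  rewrite rnorm_horizontal// /overlap -(rip_self dot)// /dg /= /g0 !ripE !rip_self//.
  rewrite rnorm_sphere pe ep pie eip.
  transitivity (th ^+ 2 * (b t ^+ 2 + a t ^+ 2 * rnorm e ^+ 2) -
    (th * (a t * b t * rnorm e ^+ 2) - th * (a t * b t)) ^+ 2); last by ring.
  by rewrite aba ba subrr expr0n subr0.
- rewrite Rintegral_cst//= lebesgue_measure_itv /= lte_fin ltr01 oppr0 addr0 /=. by rewrite mulr1.
Qed.

(** If [z = <psi, phi>] is nonzero, multiplying [phi] by the phase of the conjugate of [z] turns the
    inner product into [|z|]. *)
Lemma pi2_align psi y :
  exists phi, [/\ pi2 phi = y, 0 <= rip dot psi phi & rip dot psi ('i *: (phi : H)) = 0].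
Proof.
pose phi := repr y; pose z := inner dot psi phi.
have [z0|z0] := eqVneq z 0.
  exists phi; rewrite pi2_repr.
  by rewrite -[rip dot _ ('i *: _)]opprK -Im_inner /rip -/z z0 /= oppr0.
pose w := z^* / `|z|.
have w1 : `|w| = 1.
  by rewrite normf_div normr_id [`|z^*|](@norm_conjC R[i] z) divff ?normr_eq0.
have wphi1 : `|w *: (phi : H)| == 1 by rewrite normrZ w1 mul1r sphereP.
have wz : inner dot psi (w *: (phi : H)) = `|z|.
  rewrite /inner linearZl_LR /= -/(inner dot psi phi) -/z /w.
  rewrite mulrAC [z^* * z]mulrC -[z * z^*](@normCK R[i] z) expr2 mulfK ?normr_eq0//.
exists (Sphere wphi1); split.
- by rewrite -[RHS]pi2_repr; apply/esym/pi2P; exists w.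
- by rewrite /rip wz normc_def /= sqrtr_ge0.
- by rewrite -[LHS]opprK -Im_inner wz normc_def /= oppr0.
Qed.

Lemma FS_dist_attained x y : FS_lengths dot x y (acos (Num.sqrt (cp_overlap dot x y))).
Proof.
rewrite -(pi2_repr x); set psi := repr x.
have [phi [<- pp ipp]] := pi2_align psi y.
rewrite cp_overlapE /overlap ipp expr0n addr0 sqrtr_sqr ger0_norm//.
set a := rip dot psi phi in pp *.
have a1 : a <= 1.
  have := rip_CauchySchwarz dot dot_norm psi phi.
  by rewrite !rnorm_sphere expr1n mulr1 -/a expr2; nra.
have a11 : -1 <= a <= 1 by rewrite a1 andbT; lra.
pose s := Num.sqrt (1 - a ^+ 2).
have s2 : s ^+ 2 = 1 - a ^+ 2 by rewrite sqr_sqrtr// expr2; nra.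
(* Gram-Schmidt: [phi = a psi + r] with [r] orthogonal to [psi] and of norm [s = sin (acos a)]. *)
pose r : H := (phi : H) + (- a)%:C *: (psi : H).
have rE : rnorm r ^+ 2 = s ^+ 2.
  rewrite -(rip_self dot)// /r !ripE !rip_self// !rnorm_sphere.
  by rewrite (ripC dot phi) -/a s2; ring.
have prr : rip dot psi r = 0.
  by rewrite /r !ripE rip_self// rnorm_sphere -/a; ring.
have pir : rip dot psi ('i *: r) = 0 by rewrite /r !ripE ipp mulr0 addr0.
apply: (@geodesic_length psi phi ((s^-1)%:C *: r)).
- exact: acos_ge0.
- by rewrite ripZr prr mulr0.
- by rewrite scale_iZ ripZr pir mulr0.
(* If [s = 0], the direction [s^-1 r] is zero by the convention on inverses, but then [a = 1] and
   the angle is 0. *)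
- have [s0|s0] := eqVneq s 0; [right|left].
    move: s2; rewrite s0 expr0n /= => s2.
    have -> : a = 1 by nra.
    exact: acos1.
  rewrite rnormZ.
  have -> : rnorm r = s.
    by apply/eqP; rewrite -(@eqrXn2 _ 2%N) ?rnorm_ge0 ?sqrtr_ge0// rE.
  by rewrite ger0_norm ?mulVf// invr_ge0 sqrtr_ge0.
- rewrite sin_acos// -/s acosK ?in_itv//= scalerA -rmorphM.
  have [s0|s0] := eqVneq s 0.
    have -> : phi = a%:C *: (psi : H) :> H.
      apply/eqP; rewrite -subr_eq0 -scaleNr -rmorphN -/r -rnorm_eq0.
      by rewrite -(@sqrf_eq0 R) rE s0 expr0n.
    by rewrite s0 mul0r scale0r addr0.
  by rewrite mulfV// scale1r /r addrCA -scalerDl -rmorphD subrr scale0r addr0.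
Qed.

Lemma FS_distE x y : FS_dist dot x y = acos (Num.sqrt (cp_overlap dot x y)).
Proof.
apply/le_anti/andP; split.
  apply: ge_inf; last exact: FS_dist_attained.
  by exists (acos (Num.sqrt (cp_overlap dot x y))) => L; exact: FS_length_ge.
apply: lb_le_inf; first by eexists; exact: FS_dist_attained.
by move=> L; exact: FS_length_ge.
Qed.

End Distance.

(** * Ranges of events and the distance to them *)

Section Events.
Local Open Scope complex_scope.
Context {R : realType} {H : normedModType R[i]}.
Implicit Types (psi phi : sphere H) (x y : CP H) (E : {linear H -> H}).

Lemma acos_le (a b : R) : -1 <= a -> a <= b -> b <= 1 -> acos b <= acos a.
Proof.
move=> a1 ab b1; have a11 : -1 <= a <= 1 by lra.
have b11 : -1 <= b <= 1 by lra.
rewrite leNgt -ltr_cos ?in_itv/= ?acos_ge0 ?acos_lepi//.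
by rewrite !acosK ?in_itv//= -leNgt.
Qed.

Lemma bounded_op_continuous E : bounded_op E -> continuous E.
Proof.
move=> [M EM] u; apply/cvg_rnormP.
have vu : rnorm (u - v) @[v --> u] --> (0 : R) by exact/cvg_rnormP.
have Mvu : M * rnorm (u - v) @[v --> u] --> (0 : R).
  by rewrite -[0](mulr0 M); exact: cvgMl_tmp.
apply: squeeze_cvgr (cvg_cst 0) Mvu.
by apply: filterE => v; rewrite rnorm_ge0 -raddfB EM.
Qed.

Lemma range_idempotent E : (forall u, E (E u) = E u) -> range E = [set u | E u = u].
Proof. by move=> EE; apply/seteqP; split => [_ [u _ <-]|u <-]//; exists u. Qed.

(** The range is the zero set of the continuous map [E - id]. *)
Lemma range_event_closed E : bounded_op E -> (forall u, E (E u) = E u) ->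
  closed_vsubspace (range E).
Proof.
move=> bE EE; rewrite range_idempotent//; split => [| |a u v Eu Ev] /=.
- have -> : [set u | E u = u] = (fun u => E u - u) @^-1` [set 0].
    by apply/seteqP; split => u /= => [->|/subr0_eq//]; rewrite subrr.
  apply: closed_comp; last exact/accessible_closed_set1/hausdorff_accessible/norm_hausdorff.
  by move=> u _; apply: cvgB; [exact: bounded_op_continuous|exact: cvg_id].
- exact: linear0.
- by rewrite linearP Eu Ev.
Qed.

Lemma pi'P E y : (forall u, E (E u) = E u) ->
  pi' E y <-> exists2 phi : sphere H, E (phi : H) = (phi : H) & pi2 phi = y.
Proof.
move=> EE; rewrite /pi' range_idempotent//; split.
  by move=> [u /= Eu <-]; exists (normalize u) => //=; rewrite linearZ Eu.
move=> [phi Ephi <-].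
have phi0 : (phi : H) != 0 by rewrite -normr_eq0 (eqP (sphereP phi)) oner_eq0.
exists (Nonzero phi0) => //; congr pi2; apply: val_inj => /=.
by rewrite (eqP (sphereP phi)) invr1 scale1r.
Qed.

Variable dot : {dot H for @Num.conj R[i]}.
Hypothesis dot_norm : inner_norm dot.

(** Self-adjointness: <psi, phi> = <psi, E phi> = <E psi, phi>. *)
Lemma event_overlap E psi phi : event dot E -> E (phi : H) = (phi : H) ->
  overlap dot psi phi = overlap dot (E (psi : H)) phi.
Proof.
move=> [_ _ EC] Ephi; rewrite /overlap /rip !EC linearZ /= Ephi.
by [].
Qed.

(** With [p] the norm of [E psi], Re <psi, E psi> is [p ^+ 2], so Cauchy-Schwarz gives
    [p ^+ 4 <= p ^+ 2]. *)
Lemma event_rnorm_le1 E psi : event dot E -> rnorm (E (psi : H)) <= 1.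
Proof.
move=> [_ EE EC]; have := rip_CauchySchwarz dot dot_norm psi (E (psi : H)).
have -> : rip dot psi (E (psi : H)) = rnorm (E (psi : H)) ^+ 2.
  by rewrite -(rip_self dot)// /rip EC EE.
rewrite rnorm_sphere expr1n mul1r; have := rnorm_ge0 (E (psi : H)).
have [//|] := leP (rnorm (E (psi : H))) 1 => p1 p0.
by rewrite -exprM ler_eXn2l.
Qed.

Lemma FS_dist_event E psi : event dot E -> (exists u, E u != 0) ->
  FS_dist_set dot (pi2 psi) (pi' E) = acos (rnorm (E (psi : H))).
Proof.
move=> EE [u Eu]; have [_ Eid _] := EE; set p := rnorm (E (psi : H)).
have p0 : 0 <= p by exact: rnorm_ge0.
have p1 : p <= 1 by exact: event_rnorm_le1.
have dist phi : FS_dist dot (pi2 psi) (pi2 phi) = acos (Num.sqrt (overlap dot psi phi)).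
  by rewrite FS_distE// cp_overlapE.
have lb phi : E (phi : H) = (phi : H) -> Num.sqrt (overlap dot psi phi) <= p.
  move=> Ephi; rewrite (event_overlap _ _ _ EE Ephi) -[leRHS]ger0_norm// -sqrtr_sqr ler_wsqrtr//.
  by have := overlap_le dot dot_norm (E (psi : H)) phi; rewrite rnorm_sphere expr1n mulr1.
have lbd : lbound [set FS_dist dot (pi2 psi) y | y in pi' E] (acos p).
  move=> _ [_ /pi'P-/(_ Eid)[phi Ephi <-] <-]; rewrite dist acos_le ?lb//.
  by rewrite (le_trans _ (sqrtr_ge0 _)) ?lerN10.
have [phi [Ephi pphi]] : exists phi : sphere H,
    E (phi : H) = (phi : H) /\ Num.sqrt (overlap dot psi phi) = p.
  have N v : E v != 0 -> {phi : sphere H | E (phi : H) = (phi : H) &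
      phi = ((rnorm (E v))^-1)%:C *: E v :> H}.
    move=> Ev; have N1 : `|((rnorm (E v))^-1)%:C *: E v| == 1.
      by rewrite rnormE rnormZ ger0_norm ?invr_ge0 ?rnorm_ge0// mulVf ?rnorm_eq0.
    by exists (Sphere N1) => //=; rewrite linearZ /= Eid.
  (* If [E psi = 0] it cannot be normalized, but every unit vector of the range is then orthogonal
     to [psi]; one is obtained from [u]. *)
  have [p_0|pn0] := eqVneq p 0.
    have [phi Ephi _] := N _ Eu; exists phi; split => //.
    by apply/le_anti; rewrite lb//= p_0 sqrtr_ge0.
  have [|phi Ephi phiE] := N (psi : H).
    by rewrite -rnorm_eq0.
  exists phi; split => //; rewrite (event_overlap _ _ _ EE Ephi) phiE overlapZ.
  rewrite -/p /overlap rip_self// rip_self_i -/p.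
  rewrite (_ : _ * _ = p ^+ 2); first by rewrite sqrtr_sqr ger0_norm.
  by field.
apply/le_anti/andP; split.
  apply: ge_inf; first by exists (acos p).
  by exists (pi2 phi); [apply/pi'P => //; exists phi|rewrite dist pphi].
apply: lb_le_inf => //.
by exists (FS_dist dot (pi2 psi) (pi2 phi)), (pi2 phi) => //; apply/pi'P => //; exists phi.
Qed.

End Events.

Theorem theorem4p1 (R : realType) (H : completeNormedModType R[i])
    (dot : {dot H for @Num.conj R[i]}) (dot_norm : inner_norm dot)
    (dim_ge2 : exists u v : H, forall a b : R[i],
      a *: u + b *: v = 0 -> a = 0 /\ b = 0) :
  exists P : CP H -> set (CP H) -> R,
    (forall (psi : sphere H) (E : {linear H -> H}),
       event dot E -> (exists u, E u != 0) ->
       [/\ projective_subspace (pi' E), pi' E !=set0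
         & P (pi2 psi) (pi' E) = prob psi E]) /\
    (forall (x : CP H) (S : set (CP H)),
       projective_subspace S -> S !=set0 ->
       P x S = cos (FS_dist_set dot x S) ^+ 2).
Proof.
(* With the formula itself as [P], the second half is immediate. The first half, that [prob psi E]
   is this value, then contains the well-definedness. *)
exists (fun x S => cos (FS_dist_set dot x S) ^+ 2); split => // psi E EE [u Eu].
have [bE Eid _] := EE; split.
- by exists (range E) => //; exact: range_event_closed.
- exists (pi3 (Nonzero Eu)), (Nonzero Eu) => //; by exists u.
- rewrite FS_dist_event//; last by exists u.
  by rewrite acosK// in_itv/= (event_rnorm_le1 dot dot_norm)// andbT
    (le_trans _ (rnorm_ge0 _)) ?lerN10.
Qed.
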